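(* Let $\mathcal N=\{1,\dots,n\}$ be a universe of products with prices $p_1\ge\cdots\ge p_n\ge0$ and preference weights $v_1,\dots,v_n>0$. If $A\subseteq B\subseteq\mathcal N$, then $\llbracket A\rrbracket\subseteq\llbracket B\rrbracket$ and $\overline R(A)\ge\overline R(B)$.
   Context: For an assortment $S\subseteq\mathcal N$, the MNL expected revenue is $R(S)=\frac{\sum_{i\in S}p_iv_i}{1+\sum_{i\in S}v_i}$. The expanded revenue of $A\subseteq\mathcal N$ is $\overline R(A)=\max\{R(S): A\subseteq S\subseteq\mathcal N\}$. The expanded set $\llbracket A\rrbracket$ is the assortment $S$ with $A\subseteq S\subseteq\mathcal N$ and $R(S)=\overline R(A)$ having the largest cardinality among all such assortments (it is unique). *)

(* Defs.v *)
From HB Require Import structures.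
From mathcomp Require Import all_boot all_order all_algebra.

Set Implicit Arguments.
Unset Strict Implicit.
Unset Printing Implicit Defensive.

Import Order.TTheory GRing.Theory Num.Theory.

Local Open Scope ring_scope.

(* Products 1, ..., n are represented by 'I_n, i.e. by 0, ..., n-1. The
   no-purchase option has weight 1. *)
Definition revenue (R : realFieldType) (n : nat) (p v : 'I_n -> R)
    (S : {set 'I_n}) : R :=
  (\sum_(i in S) p i * v i) / (1 + \sum_(i in S) v i).

(* The default value revenue p v A is itself one of the values over which the
   maximum ranges (S = A). *)
Definition expanded_revenue (R : realFieldType) (n : nat) (p v : 'I_n -> R)
    (A : {set 'I_n}) : R :=
  \big[Num.max/revenue p v A]_(S : {set 'I_n} | A \subset S) revenue p v S.

Definition revenue_maximizer (R : realFieldType) (n : nat) (p v : 'I_n -> R)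
    (A S : {set 'I_n}) : bool :=
  (A \subset S) && (revenue p v S == expanded_revenue p v A).

(* The inner arg max only supplies a set known to be a maximizer; by
   expanded_setP and expanded_set_unique below, the value is the revenue
   maximizer of largest cardinality. *)
Definition expanded_set (R : realFieldType) (n : nat) (p v : 'I_n -> R)
    (A : {set 'I_n}) : {set 'I_n} :=
  let S0 := [arg max_(S > A | A \subset S) revenue p v S]%O in
  [arg max_(S > S0 | revenue_maximizer p v A S) #|S|]%N.

Section ExpandedSet.

Variables (R : realFieldType) (n : nat) (p v : 'I_n -> R).

Lemma revenue_le_expanded (A S : {set 'I_n}) :
  A \subset S -> revenue p v S <= expanded_revenue p v A.
Proof. by move=> AS; apply: (le_bigmax_cond _ (revenue p v) AS). Qed.

Lemma expanded_setP (A : {set 'I_n}) :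
  [/\ A \subset expanded_set p v A,
      revenue p v (expanded_set p v A) = expanded_revenue p v A
    & forall S : {set 'I_n}, A \subset S ->
        revenue p v S = expanded_revenue p v A ->
        (#|S| <= #|expanded_set p v A|)%N].
Proof.
rewrite /expanded_set; set S0 := Order.arg_max _ _ _.
have S0max : revenue_maximizer p v A S0.
  rewrite /S0; case: arg_maxP => // S AS Smax.
  rewrite /revenue_maximizer AS eq_le revenue_le_expanded //=.
  by apply/bigmax_leP; split=> [|T]; apply: Smax.
case: arg_maxnP => // S /andP[AS /eqP RS] Smax; split=> // T AT RT.
by apply: Smax; rewrite /revenue_maximizer AT RT eqxx.
Qed.

Hypothesis v_gt0 : forall i, 0 < v i.

Lemma revenueE (S : {set 'I_n}) (r : R) :
  revenue p v S - r =
  (\sum_(i in S) (p i - r) * v i - r) / (1 + \sum_(i in S) v i).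
Proof.
have den_neq0 : 1 + \sum_(i in S) v i != 0.
  by rewrite gt_eqF // ltr_pwDl // sumr_ge0 // => i _; apply: ltW.
apply: (mulIf den_neq0); rewrite mulrBl !divfK //.
under [in RHS]eq_bigr do rewrite mulrBl.
by rewrite sumrB -mulr_sumr mulrDr mulr1 opprD addrA addrAC.
Qed.

Lemma revenue_le (S : {set 'I_n}) (r : R) :
  (revenue p v S <= r) = (\sum_(i in S) (p i - r) * v i <= r).
Proof.
have den_gt0 : 0 < 1 + \sum_(i in S) v i.
  by rewrite ltr_pwDl // sumr_ge0 // => i _; apply: ltW.
by rewrite -subr_le0 revenueE pmulr_lle0 ?invr_gt0 // subr_le0.
Qed.

Lemma revenue_ge (S : {set 'I_n}) (r : R) :
  (r <= revenue p v S) = (r <= \sum_(i in S) (p i - r) * v i).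
Proof.
have den_gt0 : 0 < 1 + \sum_(i in S) v i.
  by rewrite ltr_pwDl // sumr_ge0 // => i _; apply: ltW.
by rewrite -subr_ge0 revenueE pmulr_lge0 ?invr_gt0 // subr_ge0.
Qed.

Lemma revenue_maximizerU (A S T : {set 'I_n}) :
  revenue_maximizer p v A S -> revenue_maximizer p v A T ->
  revenue_maximizer p v A (S :|: T).
Proof.
move=> /andP[AS /eqP RS] /andP[AT /eqP RT].
have AST : A \subset S :|: T by rewrite (subset_trans AS) ?subsetUl.
rewrite /revenue_maximizer AST eq_le revenue_le_expanded //=.
move: (expanded_revenue p v A) RS RT (@revenue_le_expanded A) => r RS RT Rle.
have := Rle (S :&: T); rewrite subsetI AS AT revenue_le => /(_ isT) hI.
have hS : r <= \sum_(i in S) (p i - r) * v i by rewrite -revenue_ge RS.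
have hT : r <= \sum_(i in T) (p i - r) * v i by rewrite -revenue_ge RT.
rewrite revenue_ge (big_setID S) /= setUK setDUl setDv set0U.
apply: (le_trans hS); rewrite lerDl.
move: hT; rewrite (big_setID S) /= [T :&: S]setIC => hT.
by have := le_trans hT (lerD hI (lexx _)); rewrite lerDl.
Qed.

Lemma expanded_set_unique (A S : {set 'I_n}) :
  A \subset S -> revenue p v S = expanded_revenue p v A ->
  (forall T : {set 'I_n}, A \subset T ->
     revenue p v T = expanded_revenue p v A -> (#|T| <= #|S|)%N) ->
  S = expanded_set p v A.
Proof.
move=> AS RS Smax; have [AE RE Emax] := expanded_setP A.
set E := expanded_set p v A in AE RE Emax *.
have /andP[AU /eqP RU] : revenue_maximizer p v A (S :|: E).
  by apply: revenue_maximizerU; rewrite /revenue_maximizer ?AS ?AE ?RS ?RE eqxx.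
have SU : S = S :|: E by apply/eqP; rewrite eqEcard subsetUl Smax.
have EU : E = S :|: E by apply/eqP; rewrite eqEcard subsetUr Emax.
by rewrite EU.
Qed.

End ExpandedSet.

(* Main.v *)
Require Import Defs.
From HB Require Import structures.
From mathcomp Require Import all_boot all_order all_algebra.

Set Implicit Arguments.
Unset Strict Implicit.
Unset Printing Implicit Defensive.

Import Order.TTheory GRing.Theory Num.Theory.

Local Open Scope ring_scope.

(** The expanded revenue is antitone because enlarging [A] shrinks the family
    of assortments over which the maximum is taken.  For the expanded sets, fix
    a revenue level [r] and linearize: an assortment [S] earns at least [r] iff
    its surplus, the sum over [S] of [(p i - r) * v i], is at least [r]
    ([revenue_ge], [revenue_le]).  The surplus is additive in [S], so optimality
    of the expanded set of [A] against its intersection with another set [T]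
    containing [A] says that the products it has outside [T] contribute a
    nonnegative surplus at the level [expanded_revenue p v A]
    ([surplus_expanded_setD_ge0]).  At the lower level [expanded_revenue p v B]
    that contribution can only grow.  Hence, with [T] the expanded set of [B],
    adding these products to [T] keeps it optimal for [B], and as [T] has the
    largest cardinality among the optimal sets, there is nothing to add. *)

Lemma expanded_revenueS (R : realFieldType) (n : nat) (p v : 'I_n -> R)
    (A B : {set 'I_n}) :
  A \subset B -> expanded_revenue p v B <= expanded_revenue p v A.
Proof.
move=> sAB; have [sBE <- _] := expanded_setP p v B.
exact/revenue_le_expanded/(subset_trans sAB).
Qed.

(** Dropping the products outside [T] leaves a candidate for [A], which cannot
    earn more than the optimum; so the dropped products have nonnegative
    surplus. *)
Lemma surplus_expanded_setD_ge0 (R : realFieldType) (n : nat) (p v : 'I_n -> R)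
    (v_gt0 : forall i : 'I_n, 0 < v i) (A T : {set 'I_n}) :
  A \subset T ->
  0 <= \sum_(i in expanded_set p v A :\: T)
         (p i - expanded_revenue p v A) * v i.
Proof.
move=> sAT; have [sAE RE _] := expanded_setP p v A.
set E := expanded_set p v A in sAE RE *; set r := expanded_revenue p v A in RE *.
have ET_le : \sum_(i in E :&: T) (p i - r) * v i <= r.
  by rewrite -revenue_le // revenue_le_expanded // subsetI sAE.
have : r <= \sum_(i in E) (p i - r) * v i by rewrite -revenue_ge // RE.
rewrite (big_setID T) /= => E_ge.
by have := le_trans E_ge (lerD ET_le (lexx _)); rewrite lerDl.
Qed.

Theorem lemma3p4 (R : realFieldType) (n : nat) (p v : 'I_n -> R)
    (p_noninc : forall i j : 'I_n, (i <= j)%N -> p j <= p i)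
    (p_ge0 : forall i : 'I_n, 0 <= p i)
    (v_gt0 : forall i : 'I_n, 0 < v i)
    (A B : {set 'I_n}) (sAB : A \subset B) :
  expanded_set p v A \subset expanded_set p v B /\
  expanded_revenue p v A >= expanded_revenue p v B.
Proof.
have rBA := expanded_revenueS p v sAB; split=> //.
have [sBT RT Tmax] := expanded_setP p v B.
have := surplus_expanded_setD_ge0 p v_gt0 (subset_trans sAB sBT).
set S := expanded_set p v A; set T := expanded_set p v B in sBT RT Tmax *.
set r := expanded_revenue p v B in rBA RT Tmax * => SD_ge0.
have sBU : B \subset T :|: S by rewrite (subset_trans sBT) ?subsetUl.
have RU : revenue p v (T :|: S) = r.
  apply/eqP; rewrite eq_le revenue_le_expanded //= revenue_ge //.
  rewrite (big_setID T) /= setUK setDUl setDv set0U.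
  have T_ge : r <= \sum_(i in T) (p i - r) * v i by rewrite -revenue_ge // RT.
  apply: (le_trans T_ge); rewrite lerDl (le_trans SD_ge0) // ler_sum // => i _.
  by rewrite ler_wpM2r ?lerB // ltW.
have /eqP -> : T == T :|: S by rewrite eqEcard subsetUl Tmax.
exact: subsetUr.
Qed.
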